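(* For $p\in(0,1]$, let $f_p$ be the function defined on $(0,\pi/2)$ by $$f_p(x)=\ln\frac{\sin x}{x}-\frac1p\ln\cos px .$$ Then $f_p$ is decreasing on $(0,\pi/2)$ if $p\in(0,1/3]$ and increasing on $(0,\pi/2)$ if $p\in[1/2,1]$. Moreover, if $p\in(0,1/3]$, then for all $x\in(0,\pi/2)$ $$\beta_p\,(\cos px)^{1/p}<\frac{\sin x}{x}<(\cos px)^{1/p},$$ where the constants $\beta_p=\frac{2}{\pi}\left(\cos\frac{p\pi}{2}\right)^{-1/p}$ and $1$ are best possible (that is, $\beta_p$ cannot be replaced by a larger constant and the factor $1$ in the upper bound cannot be replaced by a smaller constant). If $p\in[1/2,1]$ the inequalities are reversed: for all $x\in(0,\pi/2)$ $$(\cos px)^{1/p}<\frac{\sin x}{x}<\beta_p\,(\cos px)^{1/p}.$$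
   Context: For $p=1$ one has $\cos\frac{p\pi}{2}=0$, and $\beta_1$ is understood as $+\infty$, so that the upper bound in the reversed inequality is vacuous for $p=1$. *)

(* Defs.v *)
From Stdlib Require Export Reals.
Local Open Scope R_scope.

(* [ln] and [Rpower] take junk values at nonpositive arguments; for
   0 < p <= 1 and 0 < x < PI/2, both sin x / x and cos (p * x) are positive. *)
Definition f_p (p x : R) : R := ln (sin x / x) - 1 / p * ln (cos (p * x)).

(* Meaningful for 0 < p < 1 only.  Since cos (PI/2) = 0, the intended value
   at p = 1 is +oo, whereas [beta 1] is a junk real number. *)
Definition beta (p : R) : R :=
  2 / PI * Rpower (cos (p * PI / 2)) (- (1 / p)).

Definition strict_increasing_on (a b : R) (g : R -> R) : Prop :=
  forall x y : R, a < x -> x < y -> y < b -> g x < g y.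

Definition strict_decreasing_on (a b : R) (g : R -> R) : Prop :=
  forall x y : R, a < x -> x < y -> y < b -> g y < g x.

(* Main.v *)
(** The derivative is [f_p' x = cot x - 1/x + tan (p x)], which increases with
    [p], so its sign only matters at [p = 1/3] and [p = 1/2].  At [p = 1/2] it
    is [1 / sin x - 1/x > 0].  At [p = 1/3], with [T = tan t] and [t = x / 3],
    it is [(1 - T^4) / (T (3 - T^2)) - 1 / (3 t)], which is negative because
    [t < T - T^3/3 + T^5/5].  The inequalities and the sharpness of the
    constants follow from [sin x / x = exp (f_p x) * (cos (p x))^(1/p)],
    [f_p 0+ = 0] and [f_p (PI/2) = ln (beta p)]. *)
Require Import Defs.
From Stdlib Require Import Reals Lra.
From Coquelicot Require Import Coquelicot.
Open Scope R_scope.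

(** * Positivity and the derivative of [f_p] *)

Lemma cos_scaled_pos (p x : R) :
  0 < p -> 0 <= x -> p * x < PI / 2 -> 0 < cos (p * x).
Proof.
intros Hp Hx Hpx; apply cos_gt_0; [|lra].
assert (H := Rmult_le_pos p x ltac:(lra) Hx); generalize PI_RGT_0; lra.
Qed.

Lemma sinc_pos (x : R) : 0 < x < PI -> 0 < sin x / x.
Proof.
intros Hx; apply Rdiv_lt_0_compat; [apply sin_gt_0|]; lra.
Qed.

Definition df_p (p x : R) : R := cos x / sin x - 1 / x + tan (p * x).

Lemma f_p_derive (p x : R) :
  0 < p -> 0 < x < PI -> p * x < PI / 2 ->
  derivable_pt_lim (f_p p) x (df_p p x).
Proof.
intros Hp Hx Hpx.
assert (Hc := cos_scaled_pos p x Hp ltac:(lra) Hpx).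
assert (Hs := sin_gt_0 x ltac:(lra) ltac:(lra)).
apply is_derive_Reals; unfold f_p, df_p, tan.
auto_derive.
- repeat split; try lra; now apply sinc_pos.
- field; repeat split; lra.
Qed.

(** * Sign of the derivative at the two critical parameters *)

(** With T = [tan t], the right side has derivative (1 + T^2) (1 - T^2 + T^4) = 1 + T^6, so its
    excess over [t] starts at 0 and grows at rate T^6. *)
Lemma atan_series_bound (t : R) : 0 < t < PI / 2 ->
  t < tan t - tan t ^ 3 / 3 + tan t ^ 5 / 5.
Proof.
intros Ht.
assert (Hcos : forall c, 0 <= c <= t -> 0 < cos c).
{ intros c Hc; apply cos_gt_0; lra. }
destruct (MVT_cor2 (fun u => tan u - tan u ^ 3 / 3 + tan u ^ 5 / 5 - u)
            (fun u => tan u ^ 6) 0 t) as [c [Hc Hcc]]; [lra| |].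
- intros c Hc; apply is_derive_Reals.
  assert (H := Hcos c Hc).
  unfold tan; auto_derive; [repeat split; lra|].
  field; lra.
- rewrite tan_0 in Hc.
  assert (0 < tan c ^ 6) by (apply pow_lt, tan_gt_0; lra).
  assert (H1 := Rmult_lt_0_compat (tan c ^ 6) (t - 0) H ltac:(lra)).
  lra.
Qed.

Lemma df_p_third_neg (x : R) : 0 < x < PI / 2 -> df_p (1 / 3) x < 0.
Proof.
intros Hx; unfold df_p.
assert (HPI := PI_RGT_0).
set (t := x / 3).
replace (1 / 3 * x) with t by (unfold t; field).
assert (Ht : 0 < t < PI / 6) by (unfold t; lra).
assert (Hb := atan_series_bound t ltac:(lra)).
assert (HT : 0 < tan t) by (apply tan_gt_0; lra).
(* This bound, from PI/6 < PI/4, keeps 3 - T^2 and 1 - T^4 positive below. *)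
assert (HT1 : tan t < 1) by (rewrite <- tan_PI4; apply tan_increasing; lra).
assert (Hc : 0 < cos t) by (apply cos_gt_0; lra).
(* Triple-angle formulas for x = 3 t, with [cos t ^ 3] factored out of both so that it cancels. *)
assert (Hcot : cos x / sin x = (1 - 3 * tan t ^ 2) / (3 * tan t - tan t ^ 3)).
{ assert (Hsx : sin x = cos t ^ 3 * (3 * tan t - tan t ^ 3)).
  { replace x with (2 * t + t) by (unfold t; field).
    rewrite sin_plus, sin_2a, cos_2a; unfold tan; field; lra. }
  assert (Hcx : cos x = cos t ^ 3 * (1 - 3 * tan t ^ 2)).
  { replace x with (2 * t + t) by (unfold t; field).
    rewrite cos_plus, sin_2a, cos_2a; unfold tan; field; lra. }
  rewrite Hsx, Hcx.
  assert (0 < tan t * (3 - tan t ^ 2)) by (apply Rmult_lt_0_compat; nra).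
  field; split; nra. }
rewrite Hcot.
replace x with (3 * t) by (unfold t; field).
set (T := tan t) in *.
assert (H3 : 0 < 3 - T ^ 2) by nra.
replace ((1 - 3 * T ^ 2) / (3 * T - T ^ 3) - 1 / (3 * t) + T)
  with (- ((T * (3 - T ^ 2) - 3 * t * (1 - T ^ 4)) / (3 * t * (T * (3 - T ^ 2))))).
2:{ assert (0 < T * (3 - T ^ 2)) by now apply Rmult_lt_0_compat.
    field; repeat split; apply Rgt_not_eq; lra. }
apply Ropp_lt_gt_0_contravar, Rdiv_lt_0_compat.
2:{ apply Rmult_lt_0_compat; [lra|now apply Rmult_lt_0_compat]. }
assert (HT4 : 0 < 1 - T ^ 4).
{ replace (1 - T ^ 4) with ((1 - T) * (1 + T) * (1 + T ^ 2)) by ring.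
  repeat apply Rmult_lt_0_compat; nra. }
assert (H5 : 0 < T ^ 5 * (12 / 5 - T ^ 2 + 3 / 5 * T ^ 4)).
{ apply Rmult_lt_0_compat; [now apply pow_lt|].
  assert (0 < T ^ 4) by now apply pow_lt.
  nra. }
assert (H6 := Rmult_lt_compat_r (1 - T ^ 4) _ _ HT4 Hb).
(* Putting the upper bound of [atan_series_bound] in place of [t] leaves exactly the first summand;
   the second is the slack of that bound times 3 (1 - T^4). *)
replace (T * (3 - T ^ 2) - 3 * t * (1 - T ^ 4)) with
  (T ^ 5 * (12 / 5 - T ^ 2 + 3 / 5 * T ^ 4)
   + 3 * ((T - T ^ 3 / 3 + T ^ 5 / 5) * (1 - T ^ 4) - t * (1 - T ^ 4)))
  by field.
lra.
Qed.

Lemma df_p_half_pos (x : R) : 0 < x < PI / 2 -> 0 < df_p (1 / 2) x.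
Proof.
intros Hx; unfold df_p.
assert (Hs : 0 < sin x) by (apply sin_gt_0; lra).
assert (Hsh : 0 < sin (1 / 2 * x)) by (apply sin_gt_0; lra).
assert (Hch : 0 < cos (1 / 2 * x)) by (apply cos_gt_0; lra).
(* Half-angle identity: cot x + tan (x/2) = 1 / sin x. *)
replace (cos x / sin x - 1 / x + tan (1 / 2 * x)) with (/ sin x - / x).
- assert (H := Rinv_lt_contravar (sin x) x
                 ltac:(apply Rmult_lt_0_compat; lra) (sin_lt_x x ltac:(lra))).
  lra.
- replace x with (2 * (1 / 2 * x)) at 1 3 4 by field.
  rewrite sin_2a, cos_2a_cos; unfold tan.
  assert (Hsc := sin2_cos2 (1 / 2 * x)); unfold Rsqr in Hsc.
  set (s := sin (1 / 2 * x)) in *; set (k := cos (1 / 2 * x)) in *.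
  apply Rminus_diag_uniq.
  transitivity ((1 - (s * s + k * k)) / (s * k)).
  + field; repeat split; lra.
  + rewrite Hsc; field; split; lra.
Qed.

(** * Monotonicity of [f_p] *)

Lemma df_p_le (p q x : R) :
  0 < p -> p <= q -> 0 < x -> q * x < PI / 2 -> df_p p x <= df_p q x.
Proof.
intros Hp Hpq Hx Hqx; unfold df_p.
apply Rplus_le_compat_l.
destruct Hpq as [Hpq|<-]; [|lra].
assert (0 < p * x) by now apply Rmult_lt_0_compat.
left; apply tan_increasing; [generalize PI_RGT_0; lra| |lra].
now apply Rmult_lt_compat_r.
Qed.

(** The right end [y] may be PI/2 itself as long as p < 1, so that [f_p] is compared directly with
    its value there, without a limit. *)
Lemma f_p_MVT (p x y : R) :
  0 < p -> 0 < x < y -> y <= PI / 2 -> p * y < PI / 2 ->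
  exists c, x < c < y /\ f_p p y - f_p p x = df_p p c * (y - x).
Proof.
intros Hp Hxy Hy Hpy.
destruct (MVT_cor2 (f_p p) (df_p p) x y) as [c [Hc Hcxy]]; [lra| |now exists c].
intros c Hc; apply f_p_derive; [lra| |].
- generalize PI_RGT_0; lra.
- apply Rle_lt_trans with (p * y); [apply Rmult_le_compat_l; lra|lra].
Qed.

Lemma f_p_lt_small (p x y : R) :
  0 < p <= 1 / 3 -> 0 < x < y -> y <= PI / 2 -> f_p p y < f_p p x.
Proof.
intros Hp Hxy Hy.
assert (Hpy : p * y < PI / 2) by nra.
destruct (f_p_MVT p x y) as [c [Hc E]]; try lra.
assert (H := df_p_le p (1 / 3) c ltac:(lra) ltac:(lra) ltac:(lra) ltac:(lra)).
assert (H' := df_p_third_neg c ltac:(lra)).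
nra.
Qed.

Lemma f_p_lt_large (p x y : R) :
  1 / 2 <= p -> 0 < x < y -> y <= PI / 2 -> p * y < PI / 2 ->
  f_p p x < f_p p y.
Proof.
intros Hp Hxy Hy Hpy.
destruct (f_p_MVT p x y) as [c [Hc E]]; try lra.
assert (H := df_p_le (1 / 2) p c ltac:(lra) Hp ltac:(lra) ltac:(nra)).
assert (H' := df_p_half_pos c ltac:(lra)).
nra.
Qed.

(** * Behaviour at the ends of the interval, and the sign of [f_p] *)

Lemma f_p_lim_0 (p : R) : is_lim (f_p p) 0 0.
Proof.
(* The second [Finite 0] is the limit value, written as the difference of the limits of the two
   terms. *)
replace (Finite 0) with (Rbar_plus (ln 1) (Rbar_opp (1 / p * ln (cos (p * 0))))) at 2
  by (rewrite Rmult_0_r, cos_0, ln_1; simpl; f_equal; ring).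
apply (is_lim_minus' (fun x => ln (sin x / x)) (fun x => 1 / p * ln (cos (p * x)))).
- apply (is_lim_comp_continuous (fun x => sin x / x) ln 0 1); [exact is_lim_sinc_0|].
  apply (ex_derive_continuous ln); auto_derive; lra.
- apply (is_lim_continuity (fun x => 1 / p * ln (cos (p * x)))).
  apply continuity_pt_filterlim.
  apply (ex_derive_continuous (fun x => 1 / p * ln (cos (p * x)))).
  auto_derive; rewrite Rmult_0_r, cos_0; lra.
Qed.

(** Pointwise form of the limit, used for both the sign of [f_p] and the sharpness of 1. *)
Lemma f_p_near_0 (p eps b : R) : 0 < eps -> 0 < b ->
  exists x, 0 < x < b /\ Rabs (f_p p x) < eps.
Proof.
intros He Hb.
destruct (proj2 (is_lim_spec _ _ _) (f_p_lim_0 p) (mkposreal eps He)) as [d Hd].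
assert (Hd0 := cond_pos d).
assert (H1 := Rmin_l d b); assert (H2 := Rmin_r d b).
assert (H0 : 0 < Rmin d b) by now apply Rmin_glb_lt.
exists (Rmin d b / 2); split; [lra|].
rewrite <- (Rminus_0_r (f_p p _)); apply Hd; [|lra].
change (Rabs (Rmin d b / 2 - 0) < d).
rewrite Rabs_pos_eq; lra.
Qed.

Lemma f_p_near_PI2 (p eps : R) : 0 < p < 1 -> 0 < eps ->
  exists x, 0 < x < PI / 2 /\ f_p p x < f_p p (PI / 2) + eps.
Proof.
intros Hp He.
assert (HPI := PI_RGT_0).
assert (HD := f_p_derive p (PI / 2) ltac:(lra) ltac:(lra) ltac:(nra)).
assert (HC := derivable_continuous_pt _ _ (exist _ _ HD)).
destruct (HC eps He) as [d [Hd H]].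
assert (H1 := Rmin_l d (PI / 2)); assert (H2 := Rmin_r d (PI / 2)).
assert (H0 : 0 < Rmin d (PI / 2)) by (apply Rmin_glb_lt; lra).
exists (PI / 2 - Rmin d (PI / 2) / 2); split; [lra|].
assert (HR : Rabs (f_p p (PI / 2 - Rmin d (PI / 2) / 2) - f_p p (PI / 2)) < eps).
{ apply H; split; [split; [exact I|lra]|].
  change (Rabs (PI / 2 - Rmin d (PI / 2) / 2 - PI / 2) < d).
  rewrite Rabs_left; lra. }
apply Rabs_def2 in HR; lra.
Qed.

(** The midpoint gives strictness: f_p(x) >= 0 would force f_p(x/2) > 0, yet values near 0 fall
    below f_p(x/2), against monotonicity. *)
Lemma f_p_neg (p x : R) : 0 < p <= 1 / 3 -> 0 < x <= PI / 2 -> f_p p x < 0.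
Proof.
intros Hp Hx; apply Rnot_le_lt; intros H.
assert (Hh := f_p_lt_small p (x / 2) x Hp ltac:(lra) ltac:(lra)).
destruct (f_p_near_0 p (f_p p (x / 2)) (x / 2)) as [y [Hy Hy']]; [lra..|].
assert (Hm := f_p_lt_small p y (x / 2) Hp ltac:(lra) ltac:(lra)).
apply Rabs_def2 in Hy'; lra.
Qed.

Lemma f_p_pos (p x : R) :
  1 / 2 <= p -> 0 < x <= PI / 2 -> p * x < PI / 2 -> 0 < f_p p x.
Proof.
intros Hp Hx Hpx; apply Rnot_le_lt; intros H.
assert (Hh := f_p_lt_large p (x / 2) x Hp ltac:(lra) ltac:(lra) Hpx).
destruct (f_p_near_0 p (- f_p p (x / 2)) (x / 2)) as [y [Hy Hy']]; [lra..|].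
assert (Hm := f_p_lt_large p y (x / 2) Hp ltac:(lra) ltac:(lra) ltac:(nra)).
apply Rabs_def2 in Hy'; lra.
Qed.

(** * Translation into inequalities for sin x / x *)

Lemma sinc_eq_exp_f_p (p x : R) : 0 < x < PI ->
  sin x / x = exp (f_p p x) * Rpower (cos (p * x)) (1 / p).
Proof.
intros Hx; unfold f_p, Rpower.
rewrite <- exp_plus.
replace (_ - _ + _) with (ln (sin x / x)) by ring.
now rewrite exp_ln; [|apply sinc_pos].
Qed.

Lemma beta_eq_exp_f_p (p : R) : beta p = exp (f_p p (PI / 2)).
Proof.
assert (HPI := PI_RGT_0).
unfold f_p, beta, Rpower.
rewrite sin_PI2.
replace (1 / (PI / 2)) with (2 / PI) by (field; lra).
replace (p * (PI / 2)) with (p * PI / 2) by field.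
unfold Rminus; rewrite exp_plus, exp_ln by (apply Rdiv_lt_0_compat; lra).
f_equal; f_equal; ring.
Qed.

(** As an equivalence, this serves both to prove the bounds and to refute better constants. *)
Lemma mul_Rpower_lt_sinc (p c x : R) : 0 < x < PI ->
  c * Rpower (cos (p * x)) (1 / p) < sin x / x <-> c < exp (f_p p x).
Proof.
intros Hx; rewrite (sinc_eq_exp_f_p p x Hx).
assert (H : 0 < Rpower (cos (p * x)) (1 / p)) by apply exp_pos.
split; [apply Rmult_lt_reg_r|apply Rmult_lt_compat_r]; exact H.
Qed.

Lemma sinc_lt_mul_Rpower (p c x : R) : 0 < x < PI ->
  sin x / x < c * Rpower (cos (p * x)) (1 / p) <-> exp (f_p p x) < c.
Proof.
intros Hx; rewrite (sinc_eq_exp_f_p p x Hx).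
assert (H : 0 < Rpower (cos (p * x)) (1 / p)) by apply exp_pos.
split; [apply Rmult_lt_reg_r|apply Rmult_lt_compat_r]; exact H.
Qed.

Theorem theorem2 :
  forall p : R, 0 < p <= 1 ->
    (p <= 1 / 3 -> strict_decreasing_on 0 (PI / 2) (f_p p)) /\
    (1 / 2 <= p -> strict_increasing_on 0 (PI / 2) (f_p p)) /\
    (p <= 1 / 3 ->
       (forall x : R, 0 < x < PI / 2 ->
          beta p * Rpower (cos (p * x)) (1 / p) < sin x / x /\
          sin x / x < Rpower (cos (p * x)) (1 / p)) /\
       (forall c : R, beta p < c ->
          ~ (forall x : R, 0 < x < PI / 2 ->
               c * Rpower (cos (p * x)) (1 / p) < sin x / x)) /\
       (forall c : R, c < 1 ->
          ~ (forall x : R, 0 < x < PI / 2 ->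
               sin x / x < c * Rpower (cos (p * x)) (1 / p)))) /\
    (1 / 2 <= p ->
       forall x : R, 0 < x < PI / 2 ->
         Rpower (cos (p * x)) (1 / p) < sin x / x /\
         (p < 1 -> sin x / x < beta p * Rpower (cos (p * x)) (1 / p))).
Proof.
intros p Hp.
assert (HPI := PI_RGT_0).
(* [split] also introduces whatever precedes a conjunction, hence the automatically named bounds on
   [p] and [x] in several goals. *)
repeat split.
- intros Hp3 x y Hx Hxy Hy; apply f_p_lt_small; lra.
- intros Hp2 x y Hx Hxy Hy; apply f_p_lt_large; nra.
- apply mul_Rpower_lt_sinc; [lra|].
  rewrite beta_eq_exp_f_p; apply exp_increasing, f_p_lt_small; lra.
- rewrite <- (Rmult_1_l (Rpower _ _)).
  apply sinc_lt_mul_Rpower; [lra|].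
  rewrite <- exp_0; apply exp_increasing, f_p_neg; lra.
- intros c Hc Hall.
  assert (Hb := Hc); rewrite beta_eq_exp_f_p in Hb.
  assert (Hc0 : 0 < c) by (generalize (exp_pos (f_p p (PI / 2))); lra).
  rewrite <- (exp_ln c Hc0) in Hb; apply exp_lt_inv in Hb.
  (* The margin is chosen so that f_p(x) < ln c at a point near PI/2. *)
  destruct (f_p_near_PI2 p (ln c - f_p p (PI / 2))) as [x [Hx Hfx]]; [lra..|].
  apply Rlt_asym with c (exp (f_p p x)).
  + apply mul_Rpower_lt_sinc; [lra|now apply Hall].
  + rewrite <- (exp_ln c Hc0); apply exp_increasing; lra.
- intros c Hc Hall.
  assert (Hlt : forall x, 0 < x < PI / 2 -> exp (f_p p x) < c).
  { intros x Hx; apply sinc_lt_mul_Rpower; [lra|now apply Hall]. }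
  (* [ln c] is meaningful only for positive [c]; any sample point, here PI/4, shows positivity. *)
  assert (Hc0 : 0 < c).
  { apply Rlt_trans with (2 := Hlt (PI / 4) ltac:(lra)); apply exp_pos. }
  assert (Hln : ln c < 0) by (rewrite <- ln_1; now apply ln_increasing).
  (* Near 0 this gives f_p(x) > ln c, contradicting [Hlt]. *)
  destruct (f_p_near_0 p (- ln c) (PI / 2)) as [x [Hx Hfx]]; [lra..|].
  apply Rabs_def2 in Hfx.
  apply (Rlt_asym _ _ (Hlt x Hx)).
  rewrite <- (exp_ln c Hc0) at 1; apply exp_increasing; lra.
- rewrite <- (Rmult_1_l (Rpower _ _)).
  apply mul_Rpower_lt_sinc; [lra|].
  rewrite <- exp_0; apply exp_increasing, f_p_pos; nra.
(* p < 1 keeps p PI/2 below PI/2, so monotonicity reaches the endpoint where [f_p] equals ln (beta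
   p). *)
- intros Hp1; apply sinc_lt_mul_Rpower; [lra|].
  rewrite beta_eq_exp_f_p; apply exp_increasing, f_p_lt_large; nra.
Qed.
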